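(* Let $M$ be an arbitrary convex set of equivalent measures on $(\Omega,\mathcal F)$. If a nonnegative random variable $\xi$ is such that $\sup_{P\in M}E^P\xi<\infty$, then the process $\{f_m,\mathcal F_m\}_{m=0}^\infty$ with $$f_m=\operatorname{ess\,sup}_{P\in M}E^P\{\xi|\mathcal F_m\}$$ is a super-martingale relative to the convex set of equivalent measures $M$.
   Context: Let $(\Omega,\mathcal F)$ be a measurable space with a filtration $\mathcal F_0\subset\mathcal F_1\subset\dots\subset\mathcal F$, where $\mathcal F_0=\{\emptyset,\Omega\}$ and $\mathcal F=\sigma(\bigcup_{n\ge1}\mathcal F_n)$. ''Convex set of equivalent measures'' means a convex set $M$ of pairwise equivalent probability measures on $\mathcal F$. Standing assumption: for all $P,Q\in M$ the density $\frac{dP}{dQ}$ is $\mathcal F_1$-measurable and $P_0\left(\frac{dP}{dQ}>0\right)=1$, where $P_0\in M$ is a fixed measure. $E^P$ denotes expectation (or conditional expectation) with respect to $P$. An adapted process $\{f_m\}_{m=0}^\infty$ is a super-martingale relative to $M$ if $E^P|f_m|<\infty$ for all $m\ge1$, $P\in M$, and $E^P\{f_m|\mathcal F_k\}\le f_k$ for all $0\le k\le m$ and all $P\in M$. *)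

(* Defs.v *)
From HB Require Import structures.
From mathcomp Require Import all_boot all_order all_algebra.
From mathcomp Require Import all_classical all_reals all_analysis.
From mathcomp Require Import measurable_realfun.

Set Implicit Arguments.
Unset Strict Implicit.
Unset Printing Implicit Defensive.
Import Order.TTheory GRing.Theory Num.Theory.
Import numFieldNormedType.Exports.

Local Open Scope classical_set_scope.
Local Open Scope ring_scope.
Local Open Scope charge_scope.

Section sub_sigma_algebra.
Context (d : measure_display) (Omega : measurableType d).

(* For a sigma-algebra [G], the measurable sets of [g_sigma_algebraType G] are
   exactly the elements of [G]. *)
Definition measurable_wrt (d' : measure_display) (T : sigmaRingType d')
    (G : set (set Omega)) (f : Omega -> T) : Prop :=
  measurable_fun [set: g_sigma_algebraType G]
    (f : g_sigma_algebraType G -> T).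

Record is_filtration (F : nat -> set (set Omega)) : Prop := {
  filtration_sigma_algebra : forall n, sigma_algebra [set: Omega] (F n) ;
  filtration_measurable : forall n, F n `<=` measurable ;
  filtration_nondecreasing : forall n, F n `<=` F n.+1 ;
  filtration_trivial0 : F 0%N = [set set0; [set: Omega]] ;
  filtration_generates :
    (measurable : set (set Omega)) =
      <<s \bigcup_(n in [set k | (1 <= k)%N]) F n >>
}.

End sub_sigma_algebra.

Section sets_of_measures.
Context (d : measure_display) (Omega : measurableType d) (R : realType).
Implicit Types (M : set (probability Omega R)) (P Q : probability Omega R).

(* Probabilities are compared on measurable sets only: their values elsewhere
   are irrelevant. *)
Definition convex_measures M : Prop :=
  forall P Q (t : R), M P -> M Q -> 0 <= t <= 1 ->
    exists2 S, M S & forall A, measurable A ->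
      S A = (t%:E * P A + (1 - t)%:E * Q A)%E.

Definition pairwise_equivalent M : Prop :=
  forall P Q, M P -> M Q -> P `<< Q.

Definition convex_set_of_equivalent_measures M : Prop :=
  convex_measures M /\ pairwise_equivalent M.

Local Notation density P Q :=
  ('d (charge_of_finite_measure P) '/d Q).

(* A density is only defined up to a null set, so its [G]-measurability means
   that it has a [G]-measurable version. *)
Definition densities_measurable_wrt (G : set (set Omega)) M
    (P0 : probability Omega R) : Prop :=
  forall P Q, M P -> M Q ->
    (exists2 Z : Omega -> \bar R,
       measurable_wrt G Z & ae_eq Q [set: Omega] Z (density P Q)) /\
    P0 [set w | 0 < density P Q w]%E = 1%E.

End sets_of_measures.

Section conditional_expectation.
Context (d : measure_display) (Omega : measurableType d) (R : realType).
Implicit Types (P : probability Omega R) (G : set (set Omega))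
  (X Y h : Omega -> R) (M : set (probability Omega R)).

(* [Y] is a version of E^P{X | G}. *)
Definition is_cond_exp P G X Y : Prop :=
  [/\ P.-integrable [set: Omega] (EFin \o X),
      measurable_wrt G Y,
      P.-integrable [set: Omega] (EFin \o Y) &
      forall A, G A ->
        (\int[P]_(w in A) (Y w)%:E = \int[P]_(w in A) (X w)%:E)%E].

(* [h] is a version of the essential supremum of the family [S] of random
   variables: the least measurable majorant, all comparisons being P-a.s. *)
Definition is_ess_sup P (S : set (Omega -> R)) h : Prop :=
  [/\ measurable_fun [set: Omega] h,
      forall Y, S Y -> \forall w \ae P, Y w <= h w &
      forall h', measurable_fun [set: Omega] h' ->
        (forall Y, S Y -> \forall w \ae P, Y w <= h' w) ->
        \forall w \ae P, h w <= h' w].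

Definition adapted (F : nat -> set (set Omega)) (f : nat -> Omega -> R) : Prop :=
  forall m, measurable_wrt (F m) (f m).

(* The family contains every version of every E^P{xi | F_m}, P in M. *)
Definition is_ess_sup_cond_exp (F : nat -> set (set Omega)) M
    (P0 : probability Omega R) (xi : Omega -> R) (f : nat -> Omega -> R) : Prop :=
  forall m, is_ess_sup P0
    [set Y | exists2 P, M P & is_cond_exp P (F m) xi Y] (f m).

(* Conditional expectations are unique up to null sets, so it is enough that one
   version satisfies the inequality. *)
Definition is_supermartingale (F : nat -> set (set Omega)) M
    (f : nat -> Omega -> R) : Prop :=
  [/\ adapted F f,
      forall m P, (1 <= m)%N -> M P ->
        (\int[P]_w `|(f m w)%:E| < +oo)%E &
      forall k m P, (k <= m)%N -> M P ->
        exists2 Y, is_cond_exp P (F k) (f m) Y & \forall w \ae P, Y w <= f k w].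

End conditional_expectation.

(* Main.v *)
(* For P, Q in M the density dP/dQ is F_1-measurable, so for n >= 1 it can be
   pulled out of the defining identity of E^Q{xi | F_n}: integrating against P
   instead of Q only inserts an F_n-measurable weight. Hence E^P{xi | F_n} does
   not depend on P in M, and f_n, n >= 1, is its common value, a martingale under
   every P. Since F_0 is trivial, E^P{xi | F_0} is the constant E^P xi, and f_0 is the
   supremum of these constants; only E^P{f_n | F_0} <= f_0 can be strict. *)
Require Import Defs.
From HB Require Import structures.
From mathcomp Require Import all_boot all_order all_algebra.
From mathcomp Require Import all_classical all_reals all_analysis.
From mathcomp Require Import measurable_realfun.

Set Implicit Arguments.
Unset Strict Implicit.
Unset Printing Implicit Defensive.
Import Order.TTheory GRing.Theory Num.Theory.
Import numFieldNormedType.Exports.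

Local Open Scope classical_set_scope.
Local Open Scope ring_scope.

(** * Pulling a measurable weight out of integrals over preimages *)

Section pull_out.
Context d d' (T : measurableType d) (T' : measurableType d') (R : realType).
Variables (mu : {measure set T -> \bar R}) (phi : T -> T').
Hypothesis mphi : measurable_fun [set: T] phi.
Variables f g : T -> R.
Hypotheses (mf : measurable_fun [set: T] f) (mg : measurable_fun [set: T] g).
Hypotheses (f0 : forall x, 0 <= f x) (g0 : forall x, 0 <= g x).
Local Open Scope ereal_scope.

Import HBNNSimple.

Let measurable_preim A : measurable A -> measurable (phi @^-1` A).
Proof. by move=> mA; rewrite -[X in measurable X]setTI; exact: mphi. Qed.

(** Splitting [h] along its level sets leaves integrals of [u] alone over preimages, which is the
    form that the later hypothesis [fg] speaks about. *)
Lemma integral_nnsfunM_comp (D : set T') (h : {nnsfun T' >-> R}) (u : T -> R) :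
  measurable D -> measurable_fun [set: T] u -> (forall x, 0 <= u x)%R ->
  \int[mu]_(x in phi @^-1` D) ((h (phi x))%:E * (u x)%:E) =
  \sum_(r \in range h)
    r%:E * \int[mu]_(x in phi @^-1` (D `&` h @^-1` [set r])) (u x)%:E.
Proof.
move=> mD mu_ u0.
have mE := measurable_preim mD.
have mk r : measurable (phi @^-1` (h @^-1` [set r])) by exact: measurable_preim.
transitivity (\int[mu]_(x in phi @^-1` D) (\sum_(r \in range h)
    (r%:E * ((EFin \o u) \_ (phi @^-1` (h @^-1` [set r]))) x))).
  apply: eq_integral => x _; rewrite fimfunE -fsumEFin//.
  rewrite ge0_mule_fsuml; last first.
    by move=> r; rewrite EFinM nnfun_muleindic_ge0.
  apply: eq_fsbigr => r _; rewrite patchE indicE EFinM -muleA; congr (_ * _).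
  rewrite (_ : (phi x \in h @^-1` [set r]) =
      (x \in phi @^-1` (h @^-1` [set r]))).
    by case: ifP => _; rewrite ?mul1e ?mul0e.
  by apply/idP/idP; rewrite !inE.
have mp r : measurable_fun (phi @^-1` D)
    ((EFin \o u) \_ (phi @^-1` (h @^-1` [set r]))).
  apply/measurable_restrict => //.
  by apply/measurable_funTS/measurable_EFinP.
have p0 r x : 0 <= ((EFin \o u) \_ (phi @^-1` (h @^-1` [set r]))) x.
  by rewrite patchE; case: ifP => // _; rewrite lee_fin.
have rp0 r x : 0 <= r%:E * ((EFin \o u) \_ (phi @^-1` (h @^-1` [set r]))) x.
  (* Nonnegativity is asked for every real [r], not only for values of [h]; for negative [r] the
     level set is empty and the term is 0. *)
  have [r0|r0] := leP 0%R r; first by rewrite mule_ge0.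
  by rewrite preimage_nnfun0// preimage_set0 patch_set0 mule0.
rewrite ge0_integral_fsum//; last by move=> r; exact: measurable_funeM.
apply: eq_fsbigr => r rh; rewrite preimage_setI integral_mkcondr.
rewrite ge0_integralZl//.
by move: rh; rewrite inE => -[t _ <-]; rewrite lee_fin.
Qed.

Hypothesis fg : forall A, measurable A ->
  \int[mu]_(x in phi @^-1` A) (f x)%:E = \int[mu]_(x in phi @^-1` A) (g x)%:E.

(** Monotone convergence along simple approximations of [h] reduces the claim to simple weights,
    where [fg] applies on each level set intersected with [D]. *)
Lemma ge0_integralM_comp_eq (D : set T') (h : T' -> \bar R) :
  measurable D -> measurable_fun D h -> (forall y, 0 <= h y) ->
  \int[mu]_(x in phi @^-1` D) (h (phi x) * (f x)%:E) =
  \int[mu]_(x in phi @^-1` D) (h (phi x) * (g x)%:E).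
Proof.
move=> mD mh h0; have mE := measurable_preim mD.
have approx (u : T -> R) :
    measurable_fun [set: T] u -> (forall x, 0 <= u x)%R ->
    \int[mu]_(x in phi @^-1` D) (h (phi x) * (u x)%:E) =
    limn (fun n => \int[mu]_(x in phi @^-1` D)
      ((nnsfun_approx mD mh n (phi x))%:E * (u x)%:E)).
  move=> mu_ u0; rewrite -monotone_convergence//.
  - apply: eq_integral => x /[!inE] xD; apply/esym/cvg_lim => //.
    by apply: cvgeZr => //; exact: cvg_nnsfun_approx.
  - move=> n; apply/emeasurable_funM/measurable_funTS/measurable_EFinP => //.
    by apply/measurable_funTS/measurable_EFinP/measurableT_comp.
  - by move=> n x _; rewrite mule_ge0// lee_fin.
  - move=> x _ m n mn; rewrite lee_wpmul2r// lee_fin//.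
    exact/lefP/nd_nnsfun_approx.
rewrite !approx//; congr (limn _); apply/funext => n.
rewrite !integral_nnsfunM_comp//; apply: eq_fsbigr => r _.
by rewrite fg//; exact: measurableI.
Qed.

End pull_out.

(** * Measurability with respect to a sub-sigma-algebra *)

Section sub_sigma_algebra_measurability.
Context d (Omega : measurableType d) (G : set (set Omega)).
Hypotheses (hG : sigma_algebra [set: Omega] G) (Gm : G `<=` measurable).

Lemma measurable_g_sigma (A : set Omega) : G A -> G.-sigma.-measurable A.
Proof. by move=> GA; rewrite measurable_g_measurableTypeE. Qed.

Lemma g_sigma_measurable (A : set Omega) :
  G.-sigma.-measurable A -> measurable A.
Proof. by rewrite measurable_g_measurableTypeE//; exact: Gm. Qed.

Lemma measurable_id_g_sigma :
  measurable_fun [set: Omega] (id : Omega -> g_sigma_algebraType G).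
Proof.
by move=> _ A mA; rewrite setTI preimage_id; exact: g_sigma_measurable.
Qed.

Lemma measurable_wrt_measurable d' (T : measurableType d') (f : Omega -> T) :
  measurable_wrt G f -> measurable_fun [set: Omega] f.
Proof. by move=> mf _ B mB; apply: g_sigma_measurable; exact: mf. Qed.

Lemma measurable_wrtS (H : set (set Omega)) d' (T : measurableType d')
    (f : Omega -> T) :
  sigma_algebra [set: Omega] H -> G `<=` H ->
  measurable_wrt G f -> measurable_wrt H f.
Proof.
move=> hH GH mf _ B mB; rewrite measurable_g_measurableTypeE//.
by apply: GH; rewrite -(measurable_g_measurableTypeE hG); exact: mf.
Qed.

End sub_sigma_algebra_measurability.

(** * Conditional expectation: uniqueness, existence, change of measure, tower property *)

Section conditional_expectation.
Context d (Omega : measurableType d) (R : realType).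
Variable G : set (set Omega).
Hypotheses (hG : sigma_algebra [set: Omega] G) (Gm : G `<=` measurable).
Implicit Types (P Q : probability Omega R) (X Y : Omega -> R).

Let g_sigma_meas A := @g_sigma_measurable _ _ _ hG Gm A.

Let mid := measurable_id_g_sigma hG Gm.

(** The image of [P] under this map is the restriction of [P] to [G]. *)
Let idG : {mfun Omega >-> g_sigma_algebraType G} :=
  HB.pack (id : Omega -> g_sigma_algebraType G)
    (isMeasurableFun.Build _ _ _ _ _ mid).

Lemma ae_eq_cond_exp P X Y Y' : is_cond_exp P G X Y ->
  measurable_wrt G Y' -> (\forall w \ae P, Y w = Y' w) -> is_cond_exp P G X Y'.
Proof.
move=> [intX mY intY YX] mY' YY'.
have mY0 := measurable_wrt_measurable hG Gm mY.
have mY'0 := measurable_wrt_measurable hG Gm mY'.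
have YY'E : ae_eq P [set: Omega] (EFin \o Y) (EFin \o Y').
  by apply: filterS YY' => w /= ->.
split => //.
  apply/integrableP; split; first exact/measurable_EFinP.
  move/integrableP : intY => [_]; congr (_ < _)%E.
  apply: ae_eq_integral => //.
  - exact/measurableT_comp/measurable_EFinP.
  - exact/measurableT_comp/measurable_EFinP.
  - by apply: filterS YY' => w /= ->.
move=> A GA; rewrite -YX//; apply: ae_eq_integral.
- exact: Gm.
- exact/measurable_funTS/measurable_EFinP.
- exact/measurable_funTS/measurable_EFinP.
- by apply: ae_eq_subset (ae_eq_sym YY'E).
Qed.

(** The integrals of [Y] and [Y'] are known to agree only over sets of [G], so they are compared
    under the restriction of [P] to [G]; a null set found there is also null for [P]. *)
Lemma cond_exp_ae_unique P X Y Y' : is_cond_exp P G X Y ->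
  is_cond_exp P G X Y' -> \forall w \ae P, Y w = Y' w.
Proof.
move=> [intX mY intY YX] [_ mY' intY' Y'X].
have mY0 : measurable_fun [set: g_sigma_algebraType G] (EFin \o Y).
  exact/measurable_EFinP.
have mY'0 : measurable_fun [set: g_sigma_algebraType G] (EFin \o Y').
  exact/measurable_EFinP.
have : ae_eq (distribution P idG) setT
    (EFin \o Y : g_sigma_algebraType G -> \bar R) (EFin \o Y').
  apply: integral_ae_eq => //.
    by apply: integrable_pushforward.
  move=> E _ mE; have mE' := g_sigma_meas mE.
  rewrite !integral_pushforward//=.
  - by rewrite YX ?Y'X// -(measurable_g_measurableTypeE hG).
  - by apply: integrableS intY'.
  - by apply: integrableS intY.
move=> [N [mN N0 sN]]; exists N; split => //.
  exact: (g_sigma_meas mN).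
by move=> w /= YY'; apply: sN => /= /(_ I) [].
Qed.

(** The conditional expectation is the Radon-Nikodym density, on [G], of the finite measure sending
    [A] to the integral of [X] over [A], relative to the restriction of [P]. *)
Lemma cond_exp_exists P X : (forall w, 0 <= X w) ->
  P.-integrable [set: Omega] (EFin \o X) ->
  exists2 Y, is_cond_exp P G X Y & forall w, 0 <= Y w.
Proof.
move=> X0 intX.
have mX : measurable_fun [set: Omega] (EFin \o X) by exact: measurable_int intX.
pose T' := g_sigma_algebraType G.
pose nu0 : set T' -> \bar R := fun A => (\int[P]_(w in A) (X w)%:E)%E.
have nu00 : nu0 set0 = 0%E by rewrite /nu0 integral_set0.
have nu0_ge0 A : (0 <= nu0 A)%E.
  by apply: integral_ge0 => w _; rewrite lee_fin.
have nu0_sigma : semi_sigma_additive nu0.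
  move=> A mA tA mUA.
  have X0' w : (0 <= (EFin \o X) w)%E by rewrite lee_fin.
  have sigmaX := @semi_sigma_additive_nng_induced _ _ _ P _ mX X0'.
  apply: (sigmaX A) => //.
  - by move=> i; exact: g_sigma_meas.
  - exact: g_sigma_meas.
have nu0_fin : fin_num_fun nu0.
  move=> A mA; apply: integrable_fin_num.
    exact: g_sigma_meas.
  by apply: integrableS intX => //; exact: g_sigma_meas.
pose m0 := isMeasure.Build _ _ _ nu0 nu00 nu0_ge0 nu0_sigma.
pose nu1 : {measure set T' -> \bar R} := HB.pack nu0 m0.
pose m1 := Measure_isFinite.Build _ _ _ nu1 nu0_fin.
pose nu : {finite_measure set T' -> \bar R} := HB.pack nu0 m0 m1.
pose P' : probability T' R := distribution P idG.
have nuP : nu `<< P'.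
  apply/null_content_dominatesP => A mA PA.
  apply: null_set_integral => //; first exact: g_sigma_meas.
  exact: measurable_funTS.
have [f [f0 f_fin intf nuf]] := radon_nikodym_sigma_finite nuP.
(* The density is finite everywhere, so [fine] loses nothing. *)
have fE : EFin \o (fine \o f) = f by apply/funext => w /=; rewrite fineK.
have mf : measurable_fun [set: T'] f by exact: measurable_int intf.
have mff : measurable_wrt G (fine \o f).
  by apply/measurable_EFinP; rewrite fE.
exists (fine \o f); last by move=> w /=; rewrite fine_ge0.
split => //.
- rewrite fE; apply/integrableP; split.
    exact: (measurable_wrt_measurable hG Gm mf).
  move/integrableP : intf => [_]; rewrite ge0_integral_pushforward//.
  exact: measurableT_comp.
- move=> A GA; have mA := measurable_g_sigma hG GA.
  rewrite -[RHS]/(nu A) nuf// ge0_integral_pushforward//; last 1 first.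
    exact: measurable_funTS.
  by apply: eq_integral => w _ /=; rewrite fineK.
Qed.

Lemma cond_exp_change_measure P Q (Z : Omega -> \bar R) X Y : P `<< Q ->
  measurable_wrt G Z ->
  ae_eq Q [set: Omega] Z (Radon_Nikodym (charge_of_finite_measure P) Q) ->
  (forall w, 0 <= X w) -> (forall w, 0 <= Y w) ->
  P.-integrable [set: Omega] (EFin \o X) ->
  is_cond_exp Q G X Y -> is_cond_exp P G X Y.
Proof.
move=> PQ mZ ZE X0 Y0 intX [intX' mY intY YX].
have mX : measurable_fun [set: Omega] X.
  exact/measurable_EFinP/(measurable_int _ intX).
have mY0 := measurable_wrt_measurable hG Gm mY.
pose D := Radon_Nikodym_SigmaFinite.f P Q.
have mD : measurable_fun [set: Omega] D.
  exact: measurable_int (Radon_Nikodym_SigmaFinite.f_integrable PQ).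
(* [Z] agrees with the density only almost everywhere and may be negative on a null set; truncating
   at 0 gives the everywhere nonnegative weight that the pull-out lemma requires. *)
pose Z' w := maxe (Z w) 0%E.
have mZ' : measurable_wrt G Z' by exact: measurable_maxe.
have mZ'0 := measurable_wrt_measurable hG Gm mZ'.
have DZ' : ae_eq Q [set: Omega] D Z'.
  have := ae_eq_Radon_Nikodym_SigmaFinite PQ measurableT.
  apply: filterS2 ZE => w /= + + _ => /(_ I) ZD /(_ I) DD.
  rewrite /Z' ZD -DD max_l//.
  exact: Radon_Nikodym_SigmaFinite.f_ge0.
have chg (U : Omega -> R) A : measurable_fun [set: Omega] U ->
    (forall w, 0 <= U w) -> G A ->
    (\int[P]_(w in A) (U w)%:E = \int[Q]_(w in A) (Z' w * (U w)%:E))%E.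
  move=> mU U0 GA; have mA := Gm GA.
  have mEU : measurable_fun [set: Omega] (EFin \o U) by exact/measurable_EFinP.
  rewrite -(Radon_Nikodym_SigmaFinite.change_of_variables PQ)//; last first.
    exact: measurable_funTS.
  under [RHS]eq_integral do rewrite muleC.
  apply: ae_eq_integral => //.
  - exact/measurable_funTS/emeasurable_funM.
  - exact/measurable_funTS/emeasurable_funM.
  - by apply: filterS DZ' => w /(_ I) DZ _; congr (_ * _)%E.
have YXP A : G A ->
    (\int[P]_(w in A) (Y w)%:E = \int[P]_(w in A) (X w)%:E)%E.
  move=> GA; rewrite !chg//.
  (* Pull-out along the identity into [G]: the hypothesis on unweighted integrals is the defining
     identity of [Y] under [Q]. *)
  apply: (@ge0_integralM_comp_eq _ _ _ _ _ _ _ mid Y X _ _ _ _ _ A Z') => //.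
  - by move=> B mB; apply: YX; rewrite -(measurable_g_measurableTypeE hG).
  - exact: measurable_g_sigma.
  - exact: measurable_funTS.
  - by move=> w; rewrite le_max lexx orbT.
have GT : G [set: Omega].
  by rewrite -(measurable_g_measurableTypeE hG); exact: measurableT.
(* Integrability of [Y] under [P] does not follow from that under [Q]; it comes from the identity
   over the whole space, where the integral of [X] is finite. *)
split => //; apply/integrableP; split; first exact/measurable_EFinP.
under eq_integral do rewrite /= ger0_norm//.
rewrite YXP//; move/integrableP : intX => [_].
by under eq_integral do rewrite /= ger0_norm//.
Qed.

Lemma cond_exp_tower (H : set (set Omega)) P X Y Y' : G `<=` H ->
  is_cond_exp P H X Y -> is_cond_exp P G X Y' -> is_cond_exp P G Y Y'.
Proof.
move=> GH [_ _ intY YX] [_ mY' intY' Y'X]; split => // A GA.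
by rewrite Y'X// YX//; exact: GH.
Qed.

End conditional_expectation.

Lemma null_dominates_ae d (T : measurableType d) (R : realType)
    (mu nu : {measure set T -> \bar R}) (p : T -> Prop) :
  nu `<< mu -> (\forall x \ae mu, p x) -> \forall x \ae nu, p x.
Proof.
move=> /null_content_dominatesP numu [N [mN N0 sN]].
by exists N; split => //; exact: numu.
Qed.

(** * Conditioning on the trivial sigma-algebra *)

Section trivial_sigma_algebra.
Context d (Omega : measurableType d) (R : realType).
Local Notation G0 := [set set0; [set: Omega]].

(** The preimage of the single value [Y point] is empty or everything, and it contains [point]. *)
Lemma measurable_wrt_trivial (Y : Omega -> R) :
  sigma_algebra [set: Omega] G0 -> measurable_wrt G0 Y -> exists c, Y = cst c.
Proof.
move=> hG mY; exists (Y point).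
have := mY measurableT _ (measurable_set1 (Y point)).
rewrite setTI measurable_g_measurableTypeE// => -[/seteqP[+ _]|YT].
  by move=> /(_ point) /(_ erefl).
by apply/funext => w; have : (Y @^-1` [set Y point]) w by rewrite YT.
Qed.

Lemma cond_exp_trivial (P : probability Omega R) (X : Omega -> R) :
  P.-integrable [set: Omega] (EFin \o X) ->
  is_cond_exp P G0 X (cst (fine 'E_P[X])).
Proof.
move=> intX; split => //.
- exact: measurable_cst.
- exact: finite_measure_integrable_cst.
- move=> A [->|->]; first by rewrite !integral_set0.
  have EX : ('E_P[X] = \int[P]_w (X w)%:E)%E by rewrite unlock.
  have := expectation_cst P (fine 'E_P[X]); rewrite {1}unlock => ->.
  by rewrite EX fineK//; exact: integrable_fin_num.
Qed.

Lemma cond_exp_trivialE (P : probability Omega R) (X Y : Omega -> R) :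
  sigma_algebra [set: Omega] G0 ->
  is_cond_exp P G0 X Y -> Y = cst (fine 'E_P[X]).
Proof.
move=> hG [intX mY intY YX]; have [c Yc] := measurable_wrt_trivial hG mY.
have := expectation_cst P c; rewrite Yc unlock -(YX setT (or_intror erefl)) Yc.
by move=> ->.
Qed.

End trivial_sigma_algebra.

(** * The essential supremum at times n >= 1 and at time 0 *)

Section ess_sup_cond_exp.
Context d (Omega : measurableType d) (R : realType).
Variables (F : nat -> set (set Omega)) (M : set (probability Omega R)).
Variables (P0 : probability Omega R) (xi : Omega -> R).
Hypotheses (hF : is_filtration F) (hM : pairwise_equivalent M) (hP0 : M P0).
Hypothesis mxi : measurable_fun [set: Omega] xi.
Hypothesis xi_ge0 : forall w, 0 <= xi w.
Hypothesis hsup : (ereal_sup [set 'E_P[xi] | P in M] < +oo)%E.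

Let Fsa n : sigma_algebra [set: Omega] (F n) := filtration_sigma_algebra hF n.
Let Fm n : F n `<=` measurable := @filtration_measurable _ _ _ hF n.

Lemma filtration_le n m : (n <= m)%N -> F n `<=` F m.
Proof.
move=> /subnK <-; elim: (m - n)%N => [//|k IH].
by apply: subset_trans IH _; rewrite addSn; exact: filtration_nondecreasing.
Qed.

Lemma integrable_of_sup P : M P -> P.-integrable [set: Omega] (EFin \o xi).
Proof.
move=> MP; apply/integrableP; split; first exact/measurable_EFinP.
apply: le_lt_trans hsup; apply: ereal_sup_ubound; exists P => //.
by rewrite unlock; apply: eq_integral => w _ /=; rewrite ger0_norm.
Qed.

(** The conditional expectation under [P0] serves for all of [M]: as n >= 1, the densities relative
    to [P0] have [F n]-measurable versions. *)
Lemma common_cond_exp n :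
  densities_measurable_wrt (F 1%N) M P0 -> (1 <= n)%N ->
  exists Y, forall P, M P -> is_cond_exp P (F n) xi Y.
Proof.
move=> hdens n1.
have [Y YP0 Y0] :=
  cond_exp_exists (Fsa n) (@Fm n) xi_ge0 (integrable_of_sup hP0).
exists Y => P MP; have [[Z mZ ZE] _] := hdens P P0 MP hP0.
apply: (cond_exp_change_measure (Fsa n) (@Fm n) _ _ ZE) => //.
- exact: hM.
- exact: (measurable_wrtS (Fsa 1) (Fsa n) (filtration_le n1)).
- exact: integrable_of_sup.
Qed.

(** Every member of the family equals [Y] almost surely, by uniqueness and equivalence of the
    measures; [Y] is the least majorant because it belongs to the family. *)
Lemma is_ess_sup_common_cond_exp n Y :
  (forall P, M P -> is_cond_exp P (F n) xi Y) ->
  is_ess_sup P0 [set Y' | exists2 P, M P & is_cond_exp P (F n) xi Y'] Y.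
Proof.
move=> YP; have [_ mY _ _] := YP _ hP0.
split; first exact: (measurable_wrt_measurable (Fsa n) (@Fm n)).
- move=> Y' [P MP Y'P]; apply: (null_dominates_ae (hM hP0 MP)).
  have := cond_exp_ae_unique (Fsa n) (@Fm n) Y'P (YP _ MP).
  by apply: filterS => w ->.
- by move=> h _; apply; exists P0 => //; exact: YP.
Qed.

Lemma is_ess_sup_cond_exp0 : is_ess_sup P0
  [set Y | exists2 P, M P & is_cond_exp P (F 0%N) xi Y]
  (cst (fine (ereal_sup [set 'E_P[xi]%E | P in M]))).
Proof.
set s := ereal_sup _.
have F0 := filtration_trivial0 hF.
have E_ge0 P : (0 <= 'E_P[xi])%E.
  by rewrite unlock; apply: integral_ge0 => w _; rewrite lee_fin.
have Efin P : M P -> 'E_P[xi]%E \is a fin_num.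
  move=> MP; rewrite ge0_fin_numE//; apply: le_lt_trans hsup.
  by apply: ereal_sup_ubound; exists P.
have sfin : s \is a fin_num.
  rewrite ge0_fin_numE//; apply: le_trans (E_ge0 P0) _.
  by apply: ereal_sup_ubound; exists P0.
split; first exact: measurable_cst.
- move=> Y [P MP]; rewrite F0 => /cond_exp_trivialE ->; last by rewrite -F0.
  apply: aeW => w /=; apply: fine_le => //; first exact: Efin.
  by apply: ereal_sup_ubound; exists P.
- move=> h _ hmaj.
  (* [M] may be uncountable, so the null sets are collected along a sequence of measures whose
     expectations come within 1/(n+1) of the supremum. *)
  have hn n : \forall w \ae P0, fine s - n.+1%:R^-1 <= h w.
    have n0 : 0 < n.+1%:R^-1 :> R by rewrite invr_gt0.
    have [_ [P MP <-] sP] := ub_ereal_sup_adherent n0 sfin.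
    have : \forall w \ae P0, cst (fine 'E_P[xi]) w <= h w.
      apply: hmaj; exists P => //; rewrite F0.
      exact/cond_exp_trivial/integrable_of_sup.
    apply: filterS => w /=; apply: le_trans.
    rewrite -lee_fin fineK ?Efin// EFinB fineK//.
    exact: ltW.
  have := ae_foralln hn; apply: filterS => w hw /=.
  rewrite leNgt; apply/negP => /ltr_add_invr[k].
  by rewrite ltNge -lerBlDr hw.
Qed.

End ess_sup_cond_exp.

(** An essential supremum is fixed only up to null sets, so the conclusion covers every adapted
    version; the existence part shows that it is not vacuous. *)
Theorem lemma9 (d : measure_display) (Omega : measurableType d) (R : realType)
  (F : nat -> set (set Omega)) (M : set (probability Omega R))
  (P0 : probability Omega R) (xi : Omega -> R)
  (hF : is_filtration F)
  (hM : convex_set_of_equivalent_measures M)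
  (hP0 : M P0)
  (hdens : densities_measurable_wrt (F 1%N) M P0)
  (mxi : measurable_fun [set: Omega] xi)
  (xi_ge0 : forall w, 0 <= xi w)
  (hsup : (ereal_sup [set 'E_P[xi] | P in M] < +oo)%E) :
  (exists f : nat -> Omega -> R,
     adapted F f /\ is_ess_sup_cond_exp F M P0 xi f) /\
  (forall f : nat -> Omega -> R,
     adapted F f -> is_ess_sup_cond_exp F M P0 xi f ->
     is_supermartingale F M f).
Proof.
have heq := hM.2.
have Fsa := filtration_sigma_algebra hF.
have Fm := filtration_measurable hF.
have F0 := filtration_trivial0 hF.
have intxi P : M P -> P.-integrable [set: Omega] (EFin \o xi).
  exact: integrable_of_sup.
have /choice[Y YP] n :
    exists Y, (1 <= n)%N -> forall P, M P -> is_cond_exp P (F n) xi Y.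
  (* At time 0 the choice is a dummy, since the claim is restricted to n >= 1. *)
  case: n => [|n]; first by exists xi.
  have [Y YP] := common_cond_exp hF heq hP0 mxi xi_ge0 hsup hdens (ltn0Sn n).
  by exists Y.
split.
  exists (fun n => if n is 0%N
    then cst (fine (ereal_sup [set 'E_P[xi]%E | P in M])) else Y n); split.
    move=> [|n]; first exact: measurable_cst.
    by have [] := YP n.+1 isT P0 hP0.
  move=> [|n]; first exact: is_ess_sup_cond_exp0.
  by apply: is_ess_sup_common_cond_exp => //; exact: YP.
move=> f fF fsup.
(* [f n] and [Y n] are essential suprema of the same family, hence equal almost surely under [P0]
   and so under [P]. *)
have fP n P : (1 <= n)%N -> M P -> is_cond_exp P (F n) xi (f n).
  move=> n1 MP; apply: (ae_eq_cond_exp (Fsa n) (@Fm n) (YP n n1 P MP)) => //.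
  apply: (null_dominates_ae (heq _ _ MP hP0)).
  have [_ fub flub] := fsup n.
  have [mY Yub _] := is_ess_sup_common_cond_exp hF heq hP0 (YP n n1).
  have Yf : \forall w \ae P0, Y n w <= f n w.
    by apply: fub; exists P0 => //; exact: YP.
  have fY : \forall w \ae P0, f n w <= Y n w by exact: flub.
  by apply: filterS2 Yf fY => w Yf fY; apply/eqP; rewrite eq_le Yf.
split=> // [n P n1 MP|k n P kn MP].
  by have [_ _ /integrableP[]] := fP n P n1 MP.
(* For k >= 1 the tower property makes [f k] itself a version of the conditional expectation of
   [f n]: equality holds. *)
have [k0|k1] := posnP k; last first.
  exists (f k); last exact: aeW.
  apply: (cond_exp_tower (filtration_le hF kn)) (fP k P k1 MP).
  exact: fP (leq_trans k1 kn) MP.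
rewrite {k}k0 in kn *; have [n0|n1] := posnP n.
  rewrite {n}n0 in kn *.
  exists (f 0%N); last exact: aeW.
  (* Integrability at time 0 comes from adaptedness: [f 0] is constant because [F 0] is trivial. *)
  have intf0 : P.-integrable [set: Omega] (EFin \o f 0%N).
    have := fF 0%N; rewrite F0 => /measurable_wrt_trivial -[|c ->].
      by rewrite -F0.
    exact: finite_measure_integrable_cst.
  by split => //; exact: fF.
(* For k = 0 < n, conditioning [f n] on [F 0] gives the constant ['E_P[xi]], a member of the family
   that [f 0] dominates. *)
have ce : is_cond_exp P (F 0%N) xi (cst (fine 'E_P[xi])).
  by rewrite F0; exact/cond_exp_trivial/intxi.
exists (cst (fine 'E_P[xi])).
  exact: (cond_exp_tower (filtration_le hF kn) (fP n P n1 MP)).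
apply: (null_dominates_ae (heq _ _ MP hP0)).
by have [_ fub _] := fsup 0%N; apply: fub; exists P.
Qed.
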